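(* Let $q = p^r$ be a prime power ($p$ prime, $r \ge 1$), let $n \ge 1$ be an integer, and let $d$ be an integer with $d \ge q-1$. Let $X_{n,d} : \mathbb{F}_q[x_1, \ldots, x_n]_{(d,\ldots,d)} \to \mathbb{N}$ be the random variable whose value is the number of distinct zeros in $\mathbb{F}_q^n$ of a uniformly random polynomial $f \in \mathbb{F}_q[x_1,\ldots,x_n]_{(d,\ldots,d)}$. Then the expected value $E$ and the variance $V$ of $X_{n,d}$ are $$E(X_{n,d}) = q^{n-1}, \qquad V(X_{n,d}) = q^{n-1}\left(1 - \frac{1}{q}\right).$$
   Context: $\mathbb{F}_q$ is the finite field with $q$ elements. For $d \ge 0$, $\mathbb{F}_q[x_1,\ldots,x_n]_{(d,\ldots,d)}$ denotes the set of polynomials in $n$ variables over $\mathbb{F}_q$ whose degree in each variable $x_i$ is at most $d$ (including the zero polynomial); it is an $\mathbb{F}_q$-vector space of dimension $(d+1)^n$. A random polynomial is chosen uniformly from this finite set. A zero of $f$ is a point $\mathbf{p} \in \mathbb{F}_q^n$ with $f(\mathbf{p}) = 0$; zeros are counted without multiplicity. *)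

(* Defs.v *)
From HB Require Import structures.
From mathcomp Require Import all_boot all_order all_algebra.
From mathcomp Require Import mpoly.

Set Implicit Arguments.
Unset Strict Implicit.
Unset Printing Implicit Defensive.

Import GRing.Theory.
Local Open Scope ring_scope.

(* The degree of the zero polynomial in each variable is 0 here, so the zero
   polynomial has degree at most [d] in each variable, for every [d]. *)
Definition degvar (R : nzRingType) (n : nat) (i : 'I_n) (f : {mpoly R[n]}) : nat :=
  (\max_(m <- msupp f) m i)%N.

Definition degvar_le (R : nzRingType) (n d : nat) : pred {mpoly R[n]} :=
  fun f => [forall i : 'I_n, (degvar i f <= d)%N].

Record bdpoly (R : nzRingType) (n d : nat) := BdPoly {
  bdpoly_val :> {mpoly R[n]};
  _ : degvar_le d bdpoly_val
}.

HB.instance Definition _ (R : nzRingType) (n d : nat) :=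
  [isSub for @bdpoly_val R n d].
HB.instance Definition _ (R : nzRingType) (n d : nat) :=
  [Choice of bdpoly R n d by <:].

Lemma degvar_leP (R : nzRingType) (n d : nat) (f : {mpoly R[n]}) :
  reflect (forall m, m \in msupp f -> forall i, (m i <= d)%N) (degvar_le d f).
Proof.
apply: (iffP forallP) => [h m mf i|h i].
  by apply: leq_trans (h i); apply: (leq_bigmax_seq (F := fun m : 'X_{1..n} => m i)).
by apply/bigmax_leqP_seq => m mf _; apply: h.
Qed.

Section Finiteness.

Variables (R : finNzRingType) (n d : nat).

Implicit Types (f : bdpoly R n d) (e : {ffun 'I_n -> 'I_d.+1}).

Definition expo e : 'X_{1..n} := [multinom (e i : nat) | i < n].

Lemma expo_inj : injective expo.
Proof.
move=> e1 e2 /mnmP h; apply/ffunP => i; apply: val_inj.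
by move: (h i); rewrite !mnmE.
Qed.

Definition bdpoly_coefs f : {ffun {ffun 'I_n -> 'I_d.+1} -> R} :=
  [ffun e => f@_(expo e)].

Definition mpoly_of_coefs (c : {ffun {ffun 'I_n -> 'I_d.+1} -> R}) :
  {mpoly R[n]} := \sum_e c e *: 'X_[expo e].

Lemma mcoeff_of_coefs c e : (mpoly_of_coefs c)@_(expo e) = c e.
Proof.
rewrite raddf_sum (bigD1 e) //= mcoeffZ mcoeffX eqxx mulr1 big1 ?addr0 //.
by move=> e' ne; rewrite mcoeffZ mcoeffX (inj_eq expo_inj) (negPf ne) mulr0.
Qed.

Lemma degvar_le_of_coefs c : degvar_le d (mpoly_of_coefs c).
Proof.
apply/degvar_leP => m /msupp_sum_le /flattenP [_ /mapP [e _ ->]].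
by move=> /msuppZ_le; rewrite msuppX inE => /eqP -> i; rewrite mnmE -ltnS.
Qed.

Definition bdpoly_of_coefs c : bdpoly R n d := BdPoly (degvar_le_of_coefs c).

Lemma bdpoly_coefsK : cancel bdpoly_coefs bdpoly_of_coefs.
Proof.
move=> f; apply/val_inj/mpolyP => m /=.
have [/forallP le_m|/forallPn [i lt_m]] :=
    boolP [forall i, (m i <= d)%N]; last first.
  have out (g : bdpoly R n d) : g@_m = 0.
    apply/eqP; rewrite mcoeff_eq0; apply: contra lt_m => mg.
    by apply: (degvar_leP _ _ (valP g)).
  by rewrite (out f) -[LHS]/((bdpoly_of_coefs _)@_m) out.
have -> : m = expo [ffun i => inord (m i)].
  by apply/mnmP => i; rewrite mnmE ffunE inordK // ltnS.
by rewrite mcoeff_of_coefs ffunE.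
Qed.

Lemma bdpoly_of_coefsK : cancel bdpoly_of_coefs bdpoly_coefs.
Proof. by move=> c; apply/ffunP => e; rewrite ffunE mcoeff_of_coefs. Qed.

HB.instance Definition _ :=
  Countable.copy (bdpoly R n d) (can_type bdpoly_coefsK).
HB.instance Definition _ : isFinite (bdpoly R n d) :=
  CanIsFinite bdpoly_coefsK.

Lemma card_bdpoly : #|{: bdpoly R n d}| = (#|R| ^ (d.+1 ^ n))%N.
Proof.
rewrite (bij_eq_card (Bijective bdpoly_coefsK bdpoly_of_coefsK)).
by rewrite !card_ffun !card_ord.
Qed.

End Finiteness.

Definition zeros (F : finFieldType) (n : nat) (f : {mpoly F[n]}) :
  {set {ffun 'I_n -> F}} := [set v : {ffun 'I_n -> F} | f.@[v] == 0].

Definition num_zeros (F : finFieldType) (n d : nat) (f : bdpoly F n d) : nat :=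
  #|zeros f|.

(* Expectation and variance on the finite sample space [T] equipped with the
   uniform distribution. *)
Definition expectation (T : finType) (X : T -> rat) : rat :=
  (\sum_(t : T) X t) / #|T|%:R.

Definition variance (T : finType) (X : T -> rat) : rat :=
  expectation (fun t => (X t - expectation X) ^+ 2).

(* Main.v *)
Require Import Defs.
From HB Require Import structures.
From mathcomp Require Import all_boot all_order all_algebra.
From mathcomp Require Import mpoly.
From mathcomp Require Import ring.

Import GRing.Theory.
Local Open Scope ring_scope.

(** The number of zeros of [f] is the sum, over the points [v], of the indicator
    of the event [f(v) = 0], so its first two moments depend only on the joint
    laws of pairs of these events. The events behave as if the values of [f]
    were uniform and pairwise independent. Indeed, for distinct points [v] and [w], a
    polynomial of the shape [c + k x_i], where [i] is a coordinate at which
    [v] and [w] differ, takes any prescribed pair of values at [v] and [w]. Such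
    a polynomial is in the sample space because [d >= q - 1 >= 1]. Translating
    by it shows that all the fibers of [f |-> (f(v), f(w))] have the same size
    ([card_bdpoly_fiber]), so the event [f(v) = 0] has probability [1/q] and
    [f(v) = f(w) = 0] has probability [1/q^2].

    A sum of [q^n] pairwise independent indicators of probability [1/q] has
    mean [q^n / q] and, the covariances being zero, variance
    [q^n (1/q) (1 - 1/q)] ([expectation_count], [variance_count]). *)

(** * Counting pairwise independent events *)

Section Count.

Variables (T I : finType) (P : I -> pred T) (c : rat).
Hypothesis T_gt0 : (0 < #|T|)%N.
Hypothesis prob1 : forall i, \sum_t (P i t)%:R = c * #|T|%:R :> rat.

Let T_neq0 : #|T|%:R != 0 :> rat.
Proof. by rewrite Num.Theory.pnatr_eq0 -lt0n. Qed.

Lemma expectation_count :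
  expectation (fun t => \sum_i (P i t)%:R) = #|I|%:R * c.
Proof.
rewrite /expectation exchange_big /= (eq_bigr (fun=> c * #|T|%:R)) //.
by rewrite sumr_const -[_ * _ *+ _]mulr_natl mulrA mulfK.
Qed.

Hypothesis prob2 : forall i j, i != j ->
  \sum_t (P i t)%:R * (P j t)%:R = c ^+ 2 * #|T|%:R :> rat.

(** Subtracting [c] from every indicator distributes the mean over the summands,
    so that the square expands into covariances, of which only the diagonal ones
    survive. *)
Lemma variance_count :
  variance (fun t => \sum_i (P i t)%:R) = #|I|%:R * (c * (1 - c)).
Proof.
pose Z i t : rat := (P i t)%:R - c.
have cov i j :
    \sum_t Z i t * Z j t = (if i == j then c * (1 - c) else 0) * #|T|%:R.
  have -> : \sum_t Z i t * Z j t =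
      \sum_t (P i t)%:R * (P j t)%:R - c ^+ 2 * #|T|%:R.
    transitivity (\sum_t ((P i t)%:R * (P j t)%:R
        - c * (P i t)%:R - c * (P j t)%:R + c ^+ 2)).
      by apply: eq_bigr => t _; rewrite /Z; ring.
    rewrite big_split /= !sumrB -!mulr_sumr !prob1 sumr_const -[_ *+ #|_|]mulr_natr.
    ring.
  case: eqVneq => [<-|ij]; last by rewrite prob2 // subrr mul0r.
  have -> : \sum_t (P i t)%:R * (P i t)%:R = \sum_t (P i t)%:R :> rat.
    by apply: eq_bigr => t _; rewrite -natrM mulnb andbb.
  by rewrite prob1; ring.
rewrite /variance expectation_count {1}/expectation.
transitivity ((\sum_i \sum_j \sum_t Z i t * Z j t) / #|T|%:R).
  congr (_ / _); under [RHS]eq_bigr do rewrite exchange_big /=.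
  rewrite exchange_big; apply: eq_bigr => t _ /=.
  have -> : \sum_i (P i t)%:R - #|I|%:R * c = \sum_i Z i t.
    by rewrite sumrB sumr_const -[c *+ _]mulr_natl.
  by rewrite expr2 mulr_suml; apply: eq_bigr => i _; rewrite mulr_sumr.
rewrite (eq_bigr (fun=> c * (1 - c) * #|T|%:R)).
  by rewrite sumr_const -[_ * _ *+ _]mulr_natl mulrA mulfK.
move=> i _; under eq_bigr do rewrite cov.
rewrite -mulr_suml (bigD1 i) //= eqxx big1 ?addr0 // => j ji.
by rewrite eq_sym (negPf ji).
Qed.

End Count.

(** * Polynomials of bounded degree in each variable *)

Section Bdpoly.

Variables (R : nzRingType) (n d : nat).

Lemma degvar_leD (f g : {mpoly R[n]}) :
  degvar_le d f -> degvar_le d g -> degvar_le d (f + g).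
Proof.
move=> /degvar_leP hf /degvar_leP hg; apply/degvar_leP => m.
by move=> /msuppD_le; rewrite mem_cat => /orP [/hf | /hg].
Qed.

Lemma degvar_leC (c : R) : degvar_le d (c%:MP : {mpoly R[n]}).
Proof.
apply/degvar_leP => m; rewrite msuppC.
by case: ifP => // _; rewrite inE => /eqP -> i; rewrite mnm0E.
Qed.

Lemma degvar_leZX (k : R) (i : 'I_n) :
  (0 < d)%N -> degvar_le d (k *: 'X_i : {mpoly R[n]}).
Proof.
move=> d_gt0; apply/degvar_leP => m /msuppZ_le; rewrite msuppX inE => /eqP -> j.
by rewrite mnm1E; apply: leq_trans (leq_b1 _) d_gt0.
Qed.

Definition bdpoly_add (f g : bdpoly R n d) : bdpoly R n d :=
  BdPoly (degvar_leD _ _ (valP f) (valP g)).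

Lemma bdpoly_add_inj g : injective (bdpoly_add^~ g).
Proof. by move=> f1 f2 /(congr1 val) /= /addIr /val_inj. Qed.

End Bdpoly.

(** * Equidistribution of values *)

(** Adding a polynomial of value [u] maps the fiber over [0] bijectively onto
    the fiber over [u], so the sample space splits into [#|U|] fibers of equal
    size. *)
Lemma card_bdpoly_fiber (F : finNzRingType) (n d : nat) (U : finZmodType)
    (e : bdpoly F n d -> U) :
  {morph e : f g / bdpoly_add F n d f g >-> f + g} ->
  (forall u, exists h, e h = u) ->
  (#|U| * #|[set f | e f == 0%R]| = #|{: bdpoly F n d}|)%N.
Proof.
move=> eD e_surj; rewrite -[RHS]sum1_card (partition_big e predT) //=.
rewrite -sum_nat_const; apply: eq_bigr => u _; rewrite sum1_card.
have [h eh] := e_surj u.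
have add_h_bij : bijective (bdpoly_add F n d ^~ h).
  exact: injF_bij (bdpoly_add_inj F n d h).
rewrite -(on_card_preimset (onW_bij _ add_h_bij)).
apply: eq_card => f.
by rewrite !inE -[RHS]/(e _ == u) eD eh -[RHS]subr_eq0 addrK.
Qed.

HB.instance Definition _ (U V : finZmodType) := Finite.on (U * V)%type.

Section Values.

Variables (F : finFieldType) (n d : nat).

Implicit Types (v w : {ffun 'I_n -> F}).

Lemma sum_zero v :
  \sum_(f : bdpoly F n d) ((f : {mpoly F[n]}).@[v] == 0)%:R
    = #|F|%:R^-1 * #|{: bdpoly F n d}|%:R :> rat.
Proof.
have q_neq0 : #|F|%:R != 0 :> rat.
  by rewrite Num.Theory.pnatr_eq0 -lt0n; apply/card_gt0P; exists 0.
pose e (f : bdpoly F n d) := (f : {mpoly F[n]}).@[v].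
rewrite -(@card_bdpoly_fiber _ _ _ _ e).
- by rewrite natrM mulKf // -natr_sum -big_mkcond sum1dep_card.
- by move=> f g; rewrite /e mevalD.
by move=> a; exists (BdPoly (degvar_leC _ _ d a)); rewrite /e /= mevalC.
Qed.

(** The interpolating polynomial is affine in one variable, which is why degree
    one suffices. *)
Lemma bdpoly_two_values v w a b : (0 < d)%N -> v != w ->
  exists h : bdpoly F n d,
    (h : {mpoly F[n]}).@[v] = a /\ (h : {mpoly F[n]}).@[w] = b.
Proof.
move=> d_gt0 vw.
have [i vwi] : exists i, v i != w i.
  apply/existsP; apply: contraR vw; rewrite negb_exists => /forallP vw.
  by apply/eqP/ffunP => i; apply/eqP; rewrite -[_ == _]negbK.
pose k := (a - b) / (v i - w i).
have kE : k * (v i - w i) = a - b by rewrite divfK // subr_eq0.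
exists (BdPoly (degvar_leD _ _ _ _ _ (degvar_leC _ _ _ (b - k * w i))
                                      (degvar_leZX _ _ _ k i d_gt0))).
rewrite /= !mevalD !mevalC !mevalZ !mevalXU subrK; split=> //.
by rewrite -addrA [- _ + _]addrC -mulrBr kE addrC subrK.
Qed.

Lemma sum_zero2 v w : (0 < d)%N -> v != w ->
  \sum_(f : bdpoly F n d) ((f : {mpoly F[n]}).@[v] == 0)%:R
                          * ((f : {mpoly F[n]}).@[w] == 0)%:R
    = #|F|%:R^-1 ^+ 2 * #|{: bdpoly F n d}|%:R :> rat.
Proof.
move=> d_gt0 vw.
have q_neq0 : #|F|%:R != 0 :> rat.
  by rewrite Num.Theory.pnatr_eq0 -lt0n; apply/card_gt0P; exists 0.
pose e (f : bdpoly F n d) : F * F :=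
  ((f : {mpoly F[n]}).@[v], (f : {mpoly F[n]}).@[w]).
rewrite -(@card_bdpoly_fiber _ _ _ _ e).
- rewrite card_prod natrM natrM -expr2 exprVn mulKf ?expf_neq0 //.
  under eq_bigr do rewrite -natrM mulnb.
  by rewrite -natr_sum -big_mkcond sum1dep_card.
- by move=> f g; rewrite /e !mevalD.
move=> [a b]; have [h [ha hb]] := bdpoly_two_values v w a b d_gt0 vw.
by exists h; rewrite /e ha hb.
Qed.

End Values.

(** * Mean and variance of the number of zeros *)

Theorem corollary1p2 (p r q n d : nat) (F : finFieldType)
    (p_prime : prime p) (r_gt0 : (0 < r)%N) (q_def : q = (p ^ r)%N)
    (cardF : #|F| = q) (n_gt0 : (0 < n)%N) (d_ge : (q - 1 <= d)%N) :
  let X : bdpoly F n d -> rat := fun f => (num_zeros f)%:R in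
  expectation X = q%:R ^+ (n - 1) /\
  variance X = q%:R ^+ (n - 1) * (1 - 1 / q%:R).
Proof.
move=> X.
have q_gt1 : (1 < q)%N by rewrite q_def -(exp1n r) ltn_exp2r ?prime_gt1.
have d_gt0 : (0 < d)%N by apply: leq_trans d_ge; rewrite subn_gt0.
have q_neq0 : q%:R != 0 :> rat.
  by rewrite Num.Theory.pnatr_eq0 -lt0n; apply: ltnW.
pose P (v : {ffun 'I_n -> F}) (f : bdpoly F n d) := (f : {mpoly F[n]}).@[v] == 0.
pose Y (f : bdpoly F n d) : rat := \sum_v (P v f)%:R.
have XY : X =1 Y.
  by move=> f; rewrite /X /Y /num_zeros /zeros -sum1dep_card natr_sum big_mkcond;
     apply: eq_bigr => v _; rewrite /P; case: eqP.
have EXY : expectation X = expectation Y.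
  by congr (_ / _); apply: eq_bigr => f _; rewrite XY.
have VXY : variance X = variance Y.
  by congr (_ / _); apply: eq_bigr => f _; rewrite XY EXY.
have N_gt0 : (0 < #|{: bdpoly F n d}|)%N.
  by rewrite card_bdpoly expn_gt0 cardF ltnW.
have prob1 v : \sum_f (P v f)%:R = q%:R^-1 * #|{: bdpoly F n d}|%:R :> rat.
  by rewrite -cardF; apply: sum_zero.
have prob2 v w : v != w -> \sum_f (P v f)%:R * (P w f)%:R
    = q%:R^-1 ^+ 2 * #|{: bdpoly F n d}|%:R :> rat.
  by rewrite -cardF; apply: sum_zero2.
have card_points : #|{ffun 'I_n -> F}|%:R * q%:R^-1 = q%:R ^+ (n - 1) :> rat.
  by rewrite card_ffun card_ord cardF natrX -{1}(subnK n_gt0) addn1 exprSr mulfK.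
rewrite EXY VXY; split.
  by rewrite /Y (expectation_count _ _ _ _ N_gt0 prob1).
by rewrite /Y (variance_count _ _ _ _ N_gt0 prob1 prob2) mulrA card_points div1r.
Qed.
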